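(* Define $\Phi:\mathcal P(\mathcal P(\mathcal T))\to\mathcal P(\mathbf E_{\mathrm{fin}})$ by $\Phi(K):=\{E(\mathcal W):\mathcal W\subseteq K,\ \mathcal W\text{ finite}\}$ and $\Delta:\mathcal P(\mathbf E_{\mathrm{fin}})\to\mathcal P(\mathcal P(\mathcal T))$ by $\Delta(\mathcal F):=\{S\subseteq\mathcal T:\overline{\mathbf D}_S\in\mathcal F\}$. Then for all SDSes $K,K_1,K_2\subseteq\mathcal P(\mathcal T)$ and all $\mathcal F,\mathcal F_1,\mathcal F_2\subseteq\mathbf E_{\mathrm{fin}}$: (i) if $K$ is a finitely coherent SDS then $\Phi(K)$ is a proper filter on $(\mathbf E_{\mathrm{fin}},\subseteq)$; (ii) if $\mathcal F$ is a proper filter on $(\mathbf E_{\mathrm{fin}},\subseteq)$ then $\Delta(\mathcal F)$ is a finitely coherent SDS; (iii) if $K$ is a finitely coherent SDS then $\Delta(\Phi(K))=K$; (iv) if $\mathcal F$ is a proper filter on $(\mathbf E_{\mathrm{fin}},\subseteq)$ then $\Phi(\Delta(\mathcal F))=\mathcal F$; (v) if $K_1\subseteq K_2$ then $\Phi(K_1)\subseteq\Phi(K_2)$; (vi) if $\mathcal F_1\subseteq\mathcal F_2$ then $\Delta(\mathcal F_1)\subseteq\Delta(\mathcal F_2)$; (vii) $\Phi(\{S\subseteq\mathcal T:S\cap\mathcal T_+\neq\emptyset\})=\{\overline{\mathbf D}\}$ and $\Phi(\mathcal P(\mathcal T))=\mathbf E_{\mathrm{fin}}$; (viii) $\Delta(\{\overline{\mathbf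 D}\})=\{S\subseteq\mathcal T:S\cap\mathcal T_+\neq\emptyset\}$ and $\Delta(\mathbf E_{\mathrm{fin}})=\mathcal P(\mathcal T)$. Hence $\Phi$ is an order isomorphism between $(\mathbf K_{\mathrm{fin}},\subseteq)$, where $\mathbf K_{\mathrm{fin}}$ is the set of all finitely coherent SDSes together with $\mathcal P(\mathcal T)$, and the set $(\mathbf F(\mathbf E_{\mathrm{fin}}),\subseteq)$ of all filters on $(\mathbf E_{\mathrm{fin}},\subseteq)$, with inverse $\Delta$. Moreover, (ix) if a proper filter $\mathcal F$ and a finitely coherent SDS $K$ satisfy $\mathcal F=\Phi(K)$ and $K=\Delta(\mathcal F)$, then $\mathcal F$ is a prime filter on $(\mathbf E_{\mathrm{fin}},\subseteq)$ if and only if $K$ is complete, i.e. for all $S_1,S_2\subseteq\mathcal T$, $S_1\cup S_2\in K$ implies $S_1\in K$ or $S_2\in K$.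
   Context: Let $\mathcal T$ be a non-empty set (of ''things''), $\mathrm{cl}:\mathcal P(\mathcal T)\to\mathcal P(\mathcal T)$ a closure operator (extensive, monotone, idempotent), $\mathcal T_-\subseteq\mathcal T$ a set of forbidden things, $\mathcal T_+:=\mathrm{cl}(\emptyset)$, with standing assumption $\mathcal T_+\cap\mathcal T_-=\emptyset$. A coherent SDT is a $D\subseteq\mathcal T$ with $\mathrm{cl}(D)=D$ and $D\cap\mathcal T_-=\emptyset$; $\overline{\mathbf D}$ is the set of all coherent SDTs. For $\mathcal W\subseteq\mathcal P(\mathcal T)$, $\Sigma_{\mathcal W}$ is the set of maps $\sigma:\mathcal W\to\mathcal T$ with $\sigma(S)\in S$ for all $S\in\mathcal W$, and $\sigma(\mathcal W):=\{\sigma(S):S\in\mathcal W\}$. An SDS is any $K\subseteq\mathcal P(\mathcal T)$. It is finitely coherent if (K1) $\emptyset\notin K$; (K2) if $S_1\in K$ and $S_1\subseteq S_2\subseteq\mathcal T$ then $S_2\in K$; (K3) if $S\in K$ then $S\setminus\mathcal T_-\in K$; (K4) $\{t\}\in K$ for all $t\in\mathcal T_+$; (K5fin) for every non-empty finite $\mathcal W\subseteq K$ and every family $(t_\sigma)_{\sigma\in\Sigma_{\mathcal W}}$ with $t_\sigma\in\mathrm{cl}(\sigma(\mathcal W))$, $\{t_\sigma:\sigma\in\Sigma_{\mathcal W}\}\in K$. For $S\subseteq\mathcal T$ let $\overline{\mathbf D}_S:=\{D\in\overline{\mathbf D}:S\cap D\neq\emptyset\}$, for $\mathcal W\subseteq\mathcal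 P(\mathcal T)$ let $E(\mathcal W):=\bigcap_{S\in\mathcal W}\overline{\mathbf D}_S$ (with $E(\emptyset)=\overline{\mathbf D}$), and $\mathbf E_{\mathrm{fin}}:=\{E(\mathcal W):\mathcal W\subseteq\mathcal P(\mathcal T)\text{ finite}\}$, ordered by inclusion (a bounded distributive lattice with union as join, intersection as meet, bottom $\emptyset$, top $\overline{\mathbf D}$). A filter on a bounded lattice $(L,\le)$ is a non-empty $\mathcal F\subseteq L$ such that $a\in\mathcal F,a\le b\Rightarrow b\in\mathcal F$ and $a,b\in\mathcal F\Rightarrow a\wedge b\in\mathcal F$; it is proper if $\mathcal F\neq L$; a prime filter is a proper filter with $a\vee b\in\mathcal F\Rightarrow(a\in\mathcal F$ or $b\in\mathcal F)$. *)

(* Defs.v *)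
From HB Require Import structures.
From mathcomp Require Import all_boot all_order all_classical.

Set Implicit Arguments.
Unset Strict Implicit.
Unset Printing Implicit Defensive.

Import Order.TTheory.
Local Open Scope classical_set_scope.

Record closure_operator (T : Type) (cl : set T -> set T) : Prop := {
  cl_extensive : forall A, A `<=` cl A ;
  cl_monotone : forall A B, A `<=` B -> cl A `<=` cl B ;
  cl_idempotent : forall A, cl (cl A) = cl A }.

Section Filters.
Local Open Scope order_scope.
Context {d : Order.disp_t} {L : tbLatticeType d}.

Record lattice_filter (F : set L) : Prop := {
  filter_nonempty : F !=set0 ;
  filter_upward : forall a b, F a -> a <= b -> F b ;
  filter_meet : forall a b, F a -> F b -> F (Order.meet a b) }.

Definition proper_filter (F : set L) : Prop := lattice_filter F /\ F <> setT.

Definition prime_filter (F : set L) : Prop :=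
  proper_filter F /\ forall a b, F (Order.join a b) -> F a \/ F b.

End Filters.

(* [f] and [g] are mutually inverse order isomorphisms between the families of
   sets [A] and [B], both ordered by inclusion. *)
Definition inclusion_isomorphism (X Y : Type) (A : set (set X)) (B : set (set Y))
    (f : set X -> set Y) (g : set Y -> set X) : Prop :=
  [/\ set_bij A B f,
      forall U V, A U -> A V -> (U `<=` V <-> f U `<=` f V),
      forall U, A U -> g (f U) = U &
      forall V, B V -> A (g V) /\ f (g V) = V].

Section Desirability.
Context {T : Type} (cl : set T -> set T) (Tminus : set T).

Definition Tplus : set T := cl set0.

Definition coherent_SDT (D : set T) : Prop := cl D = D /\ D `&` Tminus = set0.

Definition Dbar : set (set T) := [set D | coherent_SDT D].

(* The selection maps are indexed by the sigma type associated with [W], so that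
   they carry no junk values outside [W]. *)
Definition Sigma (W : set (set T)) : set (W -> T) :=
  [set sigma | forall S : W, val S (sigma S)].
Arguments Sigma W : clear implicits.

Record finitely_coherent (K : set (set T)) : Prop := {
  fcoh_K1 : ~ K set0 ;
  fcoh_K2 : forall S1 S2, K S1 -> S1 `<=` S2 -> K S2 ;
  fcoh_K3 : forall S, K S -> K (S `\` Tminus) ;
  fcoh_K4 : forall t, Tplus t -> K [set t] ;
  fcoh_K5fin : forall W : set (set T),
    W !=set0 -> finite_set W -> W `<=` K ->
    forall t : Sigma W -> T,
      (forall sigma, cl (range (val sigma)) (t sigma)) -> K (range t) }.

Definition complete_SDS (K : set (set T)) : Prop :=
  forall S1 S2, K (S1 `|` S2) -> K S1 \/ K S2.

Definition Dbar_of (S : set T) : set (set T) :=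
  [set D | Dbar D /\ S `&` D !=set0].

(* The intersection with [Dbar] only matters for [W = set0], where [\bigcap]
   would yield the full powerset of [T]. *)
Definition events (W : set (set T)) : set (set T) :=
  Dbar `&` \bigcap_(S in W) Dbar_of S.

Definition is_fin_event (e : set (set T)) : Prop :=
  exists2 W, finite_set W & e = events W.

Definition Efin : Type := set_type [set e | is_fin_event e].

End Desirability.

Section EfinLattice.
Context {T : Type} (cl : set T -> set T) (Tminus : set T).
Local Notation Efin := (Efin cl Tminus).
Local Notation Dbar := (Dbar cl Tminus).
Local Notation Dbar_of := (Dbar_of cl Tminus).
Local Notation events := (events cl Tminus).
Local Notation is_fin_event := (is_fin_event cl Tminus).

Fact is_fin_event0 : is_fin_event set0.
Proof.
exists [set set0]; first exact: finite_set1.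
apply/seteqP; split=> // D [_ /(_ set0 erefl)[_ [x []]]] //.
Qed.

Fact is_fin_event_Dbar : is_fin_event Dbar.
Proof. by exists set0; rewrite // /events bigcap_set0 setIT. Qed.

Fact is_fin_eventI a b :
  is_fin_event a -> is_fin_event b -> is_fin_event (a `&` b).
Proof.
move=> [V finV ->] [W finW ->]; exists (V `|` W); first by rewrite finite_setU.
by rewrite /events bigcap_setU setIACA setIid.
Qed.

Fact is_fin_eventU a b :
  is_fin_event a -> is_fin_event b -> is_fin_event (a `|` b).
Proof.
move=> [V finV ->] [W finW ->].
exists ((fun p => p.1 `|` p.2) @` (V `*` W)).
  by apply: finite_image; apply: finite_setX.
apply/seteqP; split=> D.
- move=> [[DD hD]|[DD hD]]; split=> // _ [[S S'] /= [VS WS'] <-];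
    split=> //.
  + by have [_ [x [Sx Dx]]] := hD _ VS; exists x; split=> //; left.
  + by have [_ [x [Sx Dx]]] := hD _ WS'; exists x; split=> //; right.
- move=> [DD hD]; have [VD|/existsNP[S]] := pselect ((\bigcap_(S in V) Dbar_of S) D).
    by left.
  move=> /not_implyP[VS nSD]; right; split=> // S' WS'; split=> //.
  have [_ [x [[Sx|S'x] Dx]]] : Dbar_of (S `|` S') D.
    by apply: hD; exists (S, S').
  + by case: nSD; split=> //; exists x.
  + by exists x.
Qed.

HB.instance Definition _ := SubChoice.on Efin.

Fact Efin_meet_closed : meet_closed (mem [set e | is_fin_event e]).
Proof. by move=> a b; rewrite !inE; exact: is_fin_eventI. Qed.

Fact Efin_join_closed : join_closed (mem [set e | is_fin_event e]).
Proof. by move=> a b; rewrite !inE; exact: is_fin_eventU. Qed.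

Fact Efin_display : Order.disp_t. Proof. exact: Order.Disp tt tt. Qed.

HB.instance Definition _ := Order.SubChoice_isSubLattice.Build
  _ (set (set T)) _ Efin_display Efin Efin_meet_closed Efin_join_closed.

Let Efin_bot : Efin := exist _ set0 (mem_set is_fin_event0).
Let Efin_top : Efin := exist _ Dbar (mem_set is_fin_event_Dbar).

Fact Efin_le0x (a : Efin) : (Efin_bot <= a)%O.
Proof. by rewrite leEsub; apply/subsetPset. Qed.

Fact Efin_lex1 (a : Efin) : (a <= Efin_top)%O.
Proof.
rewrite leEsub; apply/subsetPset => D.
by have /set_mem[W _ ->] := valP a => -[].
Qed.

HB.instance Definition _ := Order.hasBottom.Build Efin_display Efin Efin_le0x.
HB.instance Definition _ := Order.hasTop.Build Efin_display Efin Efin_lex1.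

Fact Efin_meetUl : @left_distributive Efin Efin Order.meet Order.join.
Proof. by move=> a b c; apply: val_inj; exact: setIUl. Qed.

HB.instance Definition _ :=
  Order.Lattice_Meet_isDistrLattice.Build Efin_display Efin Efin_meetUl.

Lemma Efin_leE (a b : Efin) : (a <= b)%O <-> val a `<=` val b.
Proof. by rewrite leEsub; split=> /subsetPset. Qed.

Lemma Efin_meetE (a b : Efin) : val (Order.meet a b) = val a `&` val b.
Proof. by []. Qed.

Lemma Efin_joinE (a b : Efin) : val (Order.join a b) = val a `|` val b.
Proof. by []. Qed.

Lemma Efin_botE : val (\bot%O : Efin) = set0.
Proof. by []. Qed.

Lemma Efin_topE : val (\top%O : Efin) = Dbar.
Proof. by []. Qed.

End EfinLattice.

Section Correspondence.
Context {T : Type} (cl : set T -> set T) (Tminus : set T).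
Local Notation Efin := (Efin cl Tminus).

Definition Phi (K : set (set T)) : set Efin :=
  [set e | exists W, [/\ W `<=` K, finite_set W & val e = events cl Tminus W]].

(* [val @` F] is [F] seen as a family of sets of coherent SDTs. *)
Definition Delta (F : set Efin) : set (set T) :=
  [set S | (val @` F) (Dbar_of cl Tminus S)].

Definition Kfin : set (set (set T)) :=
  [set K | finitely_coherent cl Tminus K] `|` [set setT].

Definition Efin_filters : set (set Efin) := [set F | lattice_filter F].

End Correspondence.

Arguments Phi {T} cl Tminus K.
Arguments Delta {T cl Tminus} F.
Arguments Efin_filters {T} cl Tminus.

(* Main.v *)
(** Everything rests on one fact: for a finitely coherent SDS [K], an inclusion
    [events W `<=` Dbar_of S] with [W `<=` K] finite forces [K S].  Each
    selection [sigma] of [W] generates the closed set [cl (range sigma)]; either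
    it is coherent, hence lies in [events W] and meets [S], or it meets
    [Tminus].  Picking a point accordingly, K5fin puts a subset of
    [S `|` Tminus] in [K], and K3 removes [Tminus]. *)
Require Import Defs.
From mathcomp Require Import all_boot all_order all_classical.

Set Implicit Arguments.
Unset Strict Implicit.
Unset Printing Implicit Defensive.

Import Order.TTheory.
Local Open Scope classical_set_scope.

(** * Filters on a bounded lattice *)

Section LatticeFilter.
Context {d : Order.disp_t} {L : tbLatticeType d}.

Lemma filter_top (F : set L) : lattice_filter F -> F \top%O.
Proof.
move=> hF; have [a Fa] := filter_nonempty hF.
by apply: (filter_upward hF Fa); exact: lex1.
Qed.

Lemma filter_bot (F : set L) : lattice_filter F -> F \bot%O -> F = setT.
Proof.
move=> hF F0; apply/seteqP; split=> // a _.
by apply: (filter_upward hF F0); exact: le0x.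
Qed.

Lemma lattice_filterT : lattice_filter [set: L].
Proof. by split=> //; exists \top%O. Qed.

End LatticeFilter.

Section FiniteEvents.
Context {T : Type} (cl : set T -> set T) (Tminus : set T).
Hypothesis cl_closure : closure_operator cl.
Local Notation Efin := (Efin cl Tminus).
Local Notation Dbar := (Dbar cl Tminus).
Local Notation Dbar_of := (Dbar_of cl Tminus).
Local Notation events := (events cl Tminus).
Implicit Types (S : set T) (W K : set (set T)) (F : set Efin).

(** * Set-level calculus of [Dbar_of] and [events] *)

Lemma Dbar_of_sub S : Dbar_of S `<=` Dbar.
Proof. by move=> D []. Qed.

Lemma Dbar_ofS S1 S2 : S1 `<=` S2 -> Dbar_of S1 `<=` Dbar_of S2.
Proof.
move=> S12 D [DD [x [S1x Dx]]]; split=> //.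
by exists x; split=> //; exact: S12.
Qed.

Lemma Dbar_of0 : Dbar_of set0 = set0.
Proof. by apply/seteqP; split=> // D [_ [x []]]. Qed.

Lemma Dbar_ofU S1 S2 : Dbar_of (S1 `|` S2) = Dbar_of S1 `|` Dbar_of S2.
Proof.
apply/seteqP; split=> [D [DD [x [[S1x|S2x] Dx]]]|].
- by left; split=> //; exists x.
- by right; split=> //; exists x.
- by rewrite subUset; split; apply: Dbar_ofS => x; [left|right].
Qed.

(** A coherent SDT avoids [Tminus], so a point where it meets [S] is never forbidden. This is the
    semantic counterpart of K3. *)
Lemma Dbar_ofD S : Dbar_of (S `\` Tminus) = Dbar_of S.
Proof.
apply/seteqP; split=> [|D [[clD D0] [x [Sx Dx]]]]; first exact: Dbar_ofS.
split=> //; exists x; split=> //; split=> // xm.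
by have : (D `&` Tminus) x by []; rewrite D0.
Qed.

Lemma events_sub W S : W S -> events W `<=` Dbar_of S.
Proof. by move=> WS D [_]; exact. Qed.

Lemma events0 : events set0 = Dbar.
Proof. by rewrite /events bigcap_set0 setIT. Qed.

Lemma events1 S : events [set S] = Dbar_of S.
Proof. by rewrite /events bigcap_set1; apply/setIidPr; exact: Dbar_of_sub. Qed.

Lemma eventsU V W : events (V `|` W) = events V `&` events W.
Proof. by rewrite /events bigcap_setU setIACA setIid. Qed.

Lemma Tplus_sub_Dbar D : Dbar D -> Tplus cl `<=` D.
Proof. by move=> [<- _]; apply: (cl_monotone cl_closure). Qed.

(** Semantic counterpart of K5fin. A coherent [D] meeting every member of [W] yields a selection
    [sigma] with values in [D]; then [t sigma] lies in [cl D], which is [D]. *)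
Lemma events_sub_range W (t : @Sigma T W -> T) :
  (forall sigma, cl (range (val sigma)) (t sigma)) ->
  events W `<=` Dbar_of (range t).
Proof.
move=> ht D [DD WD]; split=> //.
have /choice[s hs] : forall S : W, exists x, val S x /\ D x.
  by move=> S; have [_] := WD _ (set_mem (valP S)).
have sW : [set sigma : W -> T | forall S : W, val S (sigma S)] s.
  by move=> S; have [] := hs S.
pose sigma : @Sigma T W := exist _ s (mem_set sW).
exists (t sigma); split; first by exists sigma.
have [clD _] := DD; rewrite -clD.
by apply: (cl_monotone cl_closure) (ht sigma) => _ [S _ <-]; have [] := hs S.
Qed.

(** * Finite events as lattice elements; monotonicity and largest values of [Phi] and [Delta] *)

Definition fin_event W (finW : finite_set W) : Efin :=
  exist _ (events W) (mem_set (ex_intro2 _ _ W finW erefl)).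

Definition event S : Efin := fin_event (finite_set1 S).

Lemma val_event S : val (event S) = Dbar_of S.
Proof. exact: events1. Qed.

Lemma Efin_eventsP (e : Efin) : exists2 W, finite_set W & val e = events W.
Proof. exact: set_mem (valP e). Qed.

(** Since [val] is injective, [event S] is the only element of [Efin] lying over [Dbar_of S]; the
    image under [val] in [Delta] thus becomes plain membership. *)
Lemma DeltaE F S : Delta F S <-> F (event S).
Proof.
split=> [[e Fe eS]|FS]; last by exists (event S); rewrite ?val_event.
by have -> : event S = e by apply: val_inj; rewrite [LHS]val_event.
Qed.

Lemma eventS S1 S2 : Dbar_of S1 `<=` Dbar_of S2 -> (event S1 <= event S2)%O.
Proof. by rewrite Efin_leE !val_event. Qed.

Lemma PhiS K1 K2 : K1 `<=` K2 -> Phi cl Tminus K1 `<=` Phi cl Tminus K2.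
Proof.
by move=> K12 e [W [WK finW eW]]; exists W; split=> //; exact: subset_trans K12.
Qed.

Lemma DeltaS F1 F2 : F1 `<=` F2 -> Delta F1 `<=` Delta F2.
Proof. by move=> F12 S [e /F12 F2e eS]; exists e. Qed.

Lemma PhiT : Phi cl Tminus setT = setT.
Proof.
apply/seteqP; split=> // e _; have [W finW eW] := Efin_eventsP e.
by exists W; split.
Qed.

Lemma DeltaT : Delta [set: Efin] = setT.
Proof. by apply/seteqP; split=> // S _; exact/DeltaE. Qed.

(** * From filters to SDSes *)

(** Induction on an enumeration of [W]: [events W] is the finite meet of the [event S] for [S] in
    [W], the empty meet being the top. *)
Lemma filter_events F W (e : Efin) : lattice_filter F -> finite_set W ->
  W `<=` Delta F -> val e = events W -> F e.
Proof.
move=> hF /finite_seqP[s ->].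
elim: s e => [|S s IHs] e sF eE.
  have -> : e = \top%O by apply: val_inj; rewrite eE set_nil events0.
  exact: filter_top.
have finS : finite_set [set` s] by exact: finite_seq.
have -> : e = Order.meet (event S) (fin_event finS).
  apply: val_inj; rewrite Efin_meetE val_event -events1 -eventsU eE.
  congr (events _); apply/seteqP; split=> S' /=.
    by rewrite in_cons => /orP[/eqP|]; [left|right].
  by rewrite in_cons => -[->|->]; rewrite ?eqxx ?orbT.
apply: (filter_meet hF).
  by apply/DeltaE/sF; rewrite /= mem_head.
by apply: IHs => // S' sS'; apply: sF; rewrite /= in_cons sS' orbT.
Qed.

(** Covers the improper filter too, as the isomorphism requires. For the inclusion of [F] in the
    left side, an element [events W] of [F] lies below each [event S] with [S] in [W], so upward
    closure gives [W] inside [Delta F]. *)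
Lemma Phi_DeltaK F : lattice_filter F -> Phi cl Tminus (Delta F) = F.
Proof.
move=> hF; apply/seteqP; split=> [e [W [WF finW eW]]|e Fe].
  exact: filter_events hF finW WF eW.
have [W finW eW] := Efin_eventsP e; exists W; split=> // S WS; apply/DeltaE.
apply: (filter_upward hF Fe); rewrite Efin_leE val_event eW.
exact: events_sub.
Qed.

(** K1 expresses properness, because [event set0] is the bottom. Each other axiom reduces to an
    inclusion between events, transported by upward closure. *)
Lemma finitely_coherent_Delta F : proper_filter F ->
  finitely_coherent cl Tminus (Delta F).
Proof.
move=> [hF FT].
have FS S1 S2 : Delta F S1 -> Dbar_of S1 `<=` Dbar_of S2 -> Delta F S2.
  move=> /DeltaE FS1 S12; apply/DeltaE.
  by apply: (filter_upward hF FS1); exact: eventS.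
split.
- move=> /DeltaE F0; apply/FT/(filter_bot hF).
  rewrite (_ : \bot%O = event set0) //.
  by apply: val_inj; rewrite val_event Dbar_of0.
- by move=> S1 S2 /FS FS1 S12; apply/FS1/Dbar_ofS.
- by move=> S /FS; apply; rewrite Dbar_ofD.
(* K4: every coherent SDT contains [Tplus cl], so the top lies below [event [set t]]. *)
- move=> t t_plus; apply/DeltaE; apply: (filter_upward hF (filter_top hF)).
  rewrite Efin_leE val_event => D DD; split=> //.
  by exists t; split=> //; exact: Tplus_sub_Dbar t_plus.
- move=> W _ finW WF t ht; apply/DeltaE.
  have FW : F (fin_event finW) by exact: (filter_events hF finW WF).
  apply: (filter_upward hF FW); rewrite Efin_leE val_event.
  exact: events_sub_range.
Qed.

(** * From finitely coherent SDSes to filters *)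

Hypothesis Tplus_Tminus : Tplus cl `&` Tminus = set0.

Lemma coherent_Tplus : Dbar (Tplus cl).
Proof. by split=> //; exact: (cl_idempotent cl_closure). Qed.

(** [Tplus cl] is the least coherent SDT: a set meets all coherent SDTs as soon as it meets this
    one. *)
Lemma Dbar_of_eq_Dbar S : Dbar_of S = Dbar <-> S `&` Tplus cl !=set0.
Proof.
split=> [SD|[x [Sx Tx]]].
  by have [] : Dbar_of S (Tplus cl) by rewrite SD; exact: coherent_Tplus.
apply/seteqP; split=> [|D DD]; first exact: Dbar_of_sub.
by split=> //; exists x; split=> //; exact: Tplus_sub_Dbar Tx.
Qed.

Lemma finitely_coherent_events K W S : finitely_coherent cl Tminus K ->
  finite_set W -> W `<=` K -> events W `<=` Dbar_of S -> K S.
Proof.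
(* K5fin says nothing about an empty [W]. In that case [S] meets every coherent SDT, in particular
   [Tplus cl], and K4 with K2 concludes. *)
move=> hK finW WK WS; have [W0|/eqP/set0P W0] := pselect (W = set0).
  have [_ [t [St Tt]]] : Dbar_of S (Tplus cl).
    by apply: WS; rewrite W0 events0; exact: coherent_Tplus.
  by apply: (fcoh_K2 hK (fcoh_K4 hK Tt)) => _ ->.
have /choice[t ht] : forall sigma : @Sigma T W, exists x,
    cl (range (val sigma)) x /\ (S `|` Tminus) x.
  move=> sigma; set D := cl _.
  have [D0|/eqP/set0P[x [Dx Tx]]] := pselect (D `&` Tminus = set0); last first.
    by exists x; split=> //; right.
  have [_ [x [Sx Dx]]] : Dbar_of S D.
    have DD : Dbar D by split=> //; exact: (cl_idempotent cl_closure).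
    apply: WS; split=> // S' WS'; split=> //.
    pose S'' : W := exist _ S' (mem_set WS').
    exists (val sigma S''); split; first exact: (set_mem (valP sigma) S'').
    by apply: (cl_extensive cl_closure); exists S''.
  by exists x; split=> //; left.
have Kt : K (range t).
  by apply: (fcoh_K5fin hK W0 finW WK) => sigma; have [] := ht sigma.
apply: (fcoh_K2 hK (fcoh_K3 hK Kt)) => _ [[sigma _ <-] ntm].
by have [_ []] := ht sigma.
Qed.

Lemma proper_filter_Phi K : finitely_coherent cl Tminus K ->
  proper_filter (Phi cl Tminus K).
Proof.
move=> hK; split; first split.
- by exists \top%O, set0; split=> //; rewrite events0.
- move=> a b [W [WK finW aW]] /Efin_leE ab.
  (* Any finite [V] presenting [b] serves as witness: for [S] in [V], [events W] is contained in
     [val b], hence in [Dbar_of S], which forces [K S]. *)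
  have [V finV bV] := Efin_eventsP b; exists V; split=> // S VS.
  apply: (finitely_coherent_events hK finW WK).
  by rewrite -aW; apply: subset_trans ab _; rewrite bV; exact: events_sub.
- move=> a b [V [VK finV aV]] [W [WK finW bW]]; exists (V `|` W); split.
  + by rewrite subUset.
  + by rewrite finite_setU.
  + by rewrite Efin_meetE aV bW eventsU.
(* If the bottom belonged to [Phi cl Tminus K], some [events W] would be empty, hence inside
   [Dbar_of set0], forcing [K set0] against K1. *)
- move=> PhiKT; have [W [WK finW W0]] : Phi cl Tminus K \bot%O.
    by rewrite PhiKT.
  apply: (fcoh_K1 hK); apply: (finitely_coherent_events hK finW WK).
  by rewrite -W0.
Qed.

Lemma Delta_PhiK K : finitely_coherent cl Tminus K ->
  Delta (Phi cl Tminus K) = K.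
Proof.
move=> hK; apply/seteqP; split=> S; last first.
  by move=> KS; apply/DeltaE; exists [set S]; split=> // _ ->.
move=> /DeltaE[W [WK finW SW]].
by apply: (finitely_coherent_events hK finW WK); rewrite -SW val_event.
Qed.

Lemma Phi_meets_Tplus :
  Phi cl Tminus [set S | S `&` Tplus cl !=set0] = [set \top%O].
Proof.
apply/seteqP; split=> [e [W [WT _ eW]]|_ ->]; last first.
  by exists set0; split=> //; rewrite events0.
apply: val_inj; rewrite eW /events; apply/setIidPl => D DD S WS.
by have /Dbar_of_eq_Dbar -> := WT S WS.
Qed.

Lemma Delta_top :
  Delta [set (\top%O : Efin)] = [set S | S `&` Tplus cl !=set0].
Proof.
apply/seteqP; split=> S.
  by move=> /DeltaE/(congr1 val); rewrite val_event => /Dbar_of_eq_Dbar.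
move=> /Dbar_of_eq_Dbar SD; apply/DeltaE/val_inj; rewrite val_event; exact: SD.
Qed.

(** * The order isomorphism, and primeness versus completeness *)

Lemma proper_filterVT F : lattice_filter F -> F = setT \/ proper_filter F.
Proof. by move=> hF; have [->|] := pselect (F = setT); [left|right]. Qed.

(** The SDS [setT] is matched with the improper filter; all other pairs come from the proper case.
    [Phi] reflects inclusion because its inverse [Delta] is monotone. *)
Lemma Phi_isomorphism : inclusion_isomorphism (Kfin cl Tminus)
  (Efin_filters cl Tminus) (Phi cl Tminus) Delta.
Proof.
have PhiK K : Kfin cl Tminus K -> Delta (Phi cl Tminus K) = K.
  by move=> [/Delta_PhiK //|->]; rewrite PhiT DeltaT.
have DeltaF F : lattice_filter F -> Kfin cl Tminus (Delta F).
  move=> /proper_filterVT[->|/finitely_coherent_Delta]; last by left.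
  by right; rewrite /= DeltaT.
split=> //; last by move=> F hF; split; [exact: DeltaF|exact: Phi_DeltaK].
- split.
  + move=> K [/proper_filter_Phi[] //|->].
    by rewrite PhiT; exact: lattice_filterT.
  + move=> K1 K2 /set_mem/PhiK hK1 /set_mem/PhiK hK2 K12.
    by rewrite -hK1 K12.
  + by move=> F hF; exists (Delta F); [exact: DeltaF|exact: Phi_DeltaK].
- move=> K1 K2 hK1 hK2; split; first exact: PhiS.
  by rewrite -{2}(PhiK _ hK1) -{2}(PhiK _ hK2); exact: DeltaS.
Qed.

(** Rests on [event] turning unions of sets of things into joins. *)
Lemma prime_Phi_complete K : finitely_coherent cl Tminus K ->
  prime_filter (Phi cl Tminus K) <-> complete_SDS K.
Proof.
move=> hK; have KE S : K S <-> Phi cl Tminus K (event S).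
  by rewrite -DeltaE Delta_PhiK.
split=> [[_ primeK] S1 S2|complK].
  rewrite !KE => KU; apply: primeK.
  rewrite (_ : Order.join _ _ = event (S1 `|` S2)) //.
  by apply: val_inj; rewrite Efin_joinE !val_event Dbar_ofU.
split=> [|a b [U [UK finU abU]]]; first exact: proper_filter_Phi.
have [V finV aV] := Efin_eventsP a; have [W finW bW] := Efin_eventsP b.
(* If neither [V] nor [W] lies inside [K], pick [S] in [V] and [S'] in [W] outside [K]. The join of
   [a] and [b] is contained in the event of their union, so the union is in [K], contradicting
   completeness. *)
have [VK|/existsNP[S /not_implyP[VS nKS]]] := pselect (V `<=` K).
  by left; exists V.
have [WK|/existsNP[S' /not_implyP[WS' nKS']]] := pselect (W `<=` K).
  by right; exists W.
have /complK[] // : K (S `|` S').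
apply: (finitely_coherent_events hK finU UK).
rewrite -abU Efin_joinE aV bW Dbar_ofU.
by apply: setUSS; exact: events_sub.
Qed.

End FiniteEvents.

Theorem theorem5 (T : Type) (cl : set T -> set T) (Tminus : set T)
    (T_neq0 : [set: T] !=set0)
    (cl_closure : closure_operator cl)
    (Tplus_Tminus : Tplus cl `&` Tminus = set0) :
  (forall K : set (set T), finitely_coherent cl Tminus K ->
     proper_filter (Phi cl Tminus K)) /\
  (forall F : set (Efin cl Tminus), proper_filter F ->
     finitely_coherent cl Tminus (Delta F)) /\
  (forall K : set (set T), finitely_coherent cl Tminus K ->
     Delta (Phi cl Tminus K) = K) /\
  (forall F : set (Efin cl Tminus), proper_filter F ->
     Phi cl Tminus (Delta F) = F) /\
  (forall K1 K2 : set (set T), K1 `<=` K2 ->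
     Phi cl Tminus K1 `<=` Phi cl Tminus K2) /\
  (forall F1 F2 : set (Efin cl Tminus), F1 `<=` F2 ->
     Delta F1 `<=` Delta F2) /\
  (Phi cl Tminus [set S | S `&` Tplus cl !=set0] = [set \top%O] /\
   Phi cl Tminus [set: set T] = [set: Efin cl Tminus]) /\
  (Delta [set (\top%O : Efin cl Tminus)] = [set S | S `&` Tplus cl !=set0] /\
   Delta [set: Efin cl Tminus] = [set: set T]) /\
  inclusion_isomorphism (Kfin cl Tminus) (Efin_filters cl Tminus)
    (Phi cl Tminus) Delta /\
  (forall (F : set (Efin cl Tminus)) (K : set (set T)),
     proper_filter F -> finitely_coherent cl Tminus K ->
     F = Phi cl Tminus K -> K = Delta F ->
     (prime_filter F <-> complete_SDS K)).
Proof.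
split; first by move=> K; exact: proper_filter_Phi.
split; first by move=> F; exact: finitely_coherent_Delta.
split; first by move=> K; exact: Delta_PhiK.
split; first by move=> F [hF _]; exact: Phi_DeltaK.
split; first by move=> K1 K2; exact: PhiS.
split; first by move=> F1 F2; exact: DeltaS.
split; first by split; [exact: Phi_meets_Tplus|exact: PhiT].
split; first by split; [exact: Delta_top|exact: DeltaT].
split; first exact: Phi_isomorphism.
by move=> F K _ hK -> _; exact: prime_Phi_complete.
Qed.
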